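(* Let $X$ be a Banach space and let $\kappa$ be an infinite cardinal. Then: (1) If $X$ is a $\mathrm{UD}_{<\kappa}$ space, then $\mathfrak{pDau}(X)\geq\kappa$. (2) If $X$ is an $\mathrm{AUD}_{<\kappa}$ space, then $\mathfrak{Dau}(X)\geq\kappa$.
   Context: All Banach spaces are real. $\operatorname{dens}(Z)$ is the least cardinality of a subset of $Z$ spanning a dense subspace of $Z$ (so it is the dimension for finite-dimensional $Z$). A Banach space $X$ is of universal disposition for density $\kappa$ ($\mathrm{UD}_{<\kappa}$) if for any two normed spaces $Y\subseteq Z$ with $\operatorname{dens}(Z)<\kappa$ and any (linear, into) isometry $t:Y\to X$ there exists a linear extension $T:Z\to X$ of $t$ which is an isometry. $X$ is of almost universal disposition for density $\kappa$ ($\mathrm{AUD}_{<\kappa}$) if for any such $Y\subseteq Z$ and $t$ and for every $\varepsilon>0$ there exists a linear extension $T:Z\to X$ of $t$ with $(1-\varepsilon)\|z\|\leq\|T(z)\|\leq(1+\varepsilon)\|z\|$ for every $z\in Z$. $B_X$ and $S_X$ denote the closed unit ball and unit sphere of $X$. A slice of $B_X$ is a nonempty intersection of $B_X$ with an open half-space, i.e. a set $\{x\in B_X: f(x)>\sup f(B_X)-\alpha\}$ with $f\in X^*$, $\alpha>0$. For a cardinal $\kappa$ (finite or infinite), $\{y_\alpha:\alpha<\kappa\}$ denotes a set of cardinality at most $\kappa$. $X$ has the $\kappa$-Daugavet property if for every family $\{y_\alpha:\alpha<\kappa\}\subseteq S_X$, every slice $S$ of $B_X$ and every $\varepsilon>0$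 there is $x\in S$ with $\|y_\alpha+x\|>2-\varepsilon$ for all $\alpha<\kappa$. $X$ has the $\kappa$-perfect Daugavet property if for every family $\{y_\alpha:\alpha<\kappa\}\subseteq S_X$ and every slice $S$ of $B_X$ there is $x\in S$ with $\|y_\alpha+x\|=2$ for all $\alpha<\kappa$. For nonzero $X$, $\mathfrak{Dau}(X)$ (resp. $\mathfrak{pDau}(X)$) is the least cardinal $\kappa$ such that $X$ fails the $\kappa$-Daugavet (resp. $\kappa$-perfect Daugavet) property. *)

(* Defs.v *)
From HB Require Import structures.
From mathcomp Require Import all_boot all_order all_algebra.
From mathcomp Require Import all_classical all_reals all_analysis.

Set Implicit Arguments.
Unset Strict Implicit.
Unset Printing Implicit Defensive.
Import Order.TTheory GRing.Theory Num.Theory.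
Import numFieldNormedType.Exports.

Local Open Scope classical_set_scope.
Local Open Scope card_scope.
Local Open Scope ring_scope.

(* A cardinal is represented by a type of that cardinality; two types stand for
   the same cardinal when they are equipotent. *)

Definition card_lt (A B : Type) : Prop :=
  [set: A] #<= [set: B] /\ ~ ([set: B] #<= [set: A]).

Definition is_least_cardinal (P : Type -> Prop) (L : Type) : Prop :=
  P L /\ forall M : Type, P M -> [set: L] #<= [set: M].

(* The value is the junk type [void] when no cardinal satisfies [P]. *)
Definition least_cardinal (P : Type -> Prop) : Type :=
  if pselect (exists L, is_least_cardinal P L) is left exL
  then sval (cid exL) else void.

(* Zorn's lemma is applied to the sets of choice functions on [S] that are
   pairwise distinct in every coordinate: for a maximal such set [F], some
   member of [S] is exhausted by [F], hence injects in all the others. *)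
Lemma least_set_in (U : Type) (S : set (set U)) :
  S !=set0 -> exists2 A, S A & forall B, S B -> A #<= B.
Proof.
move=> [A0 SA0].
pose good (F : set (set U -> U)) :=
  (forall f, F f -> forall A, S A -> A (f A)) /\
  (forall f g, F f -> F g -> forall A, S A -> f A = g A -> f = g).
have [F [[Fch Finj] maxF]] : exists F, good F /\ forall G, F `<` G -> ~ good G.
  apply: Zorn_bigcup => C Cgood Ctot; split.
    by move=> f [F CF Ff]; exact: (Cgood _ CF).1.
  move=> f g [F CF Ff] [G CG Gg].
  have [FG|GF] := Ctot _ _ CF CG.
  - exact: (Cgood _ CG).2 (FG _ Ff) Gg.
  - exact: (Cgood _ CF).2 Ff (GF _ Gg).
have [A SA FA] : exists2 A, S A & forall a, A a -> exists2 f, F f & f A = a.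
  apply: contrapT => nF.
  have hP A : exists a, S A -> A a /\ forall f, F f -> f A <> a.
    have [SA|nSA] := pselect (S A); last first.
      have [[u _]|A0e] := pselect (A0 !=set0); first by exists u.
      exfalso; apply: nF; exists A0 => // a A0a.
      by exfalso; apply: A0e; exists a.
    apply: contrapT => /forallNP na; apply: nF; exists A => // a Aa.
    apply: contrapT => nfa; apply: (na a) => _; split=> // f Ff fa.
    by apply: nfa; exists f.
  pose h A := sval (cid (hP A)).
  have hE A : S A -> A (h A) /\ forall f, F f -> f A <> h A.
    exact: (svalP (cid (hP A))).
  apply: (maxF (F `|` [set h])).
    split; first by move=> f Ff; left.
    by move=> /(_ h (or_intror erefl)) Fh; exact: ((hE _ SA0).2 _ Fh).
  split; first by move=> f [Ff|->] B SB; [exact: Fch f Ff B SB|exact: (hE _ SB).1].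
  move=> f g [Ff|->] [Fg|->] B SB //; first exact: Finj.
  - by move=> fh; case: ((hE _ SB).2 _ Ff).
  - by move=> hg; case: ((hE _ SB).2 _ Fg).
exists A => // B SB.
have sP a : exists f, A a -> F f /\ f A = a.
  have [Aa|nAa] := pselect (A a); last by exists (fun=> a).
  by have [f Ff fa] := FA _ Aa; exists f.
pose s a := sval (cid (sP a)).
have sE a : A a -> F (s a) /\ s a A = a by exact: (svalP (cid (sP a))).
suff /injfunPex[f] : exists2 f : U -> U, set_fun A B f & set_inj A f.
  exact: inj_card_le.
exists (fun a => s a B); first by move=> a /sE[Fa _]; exact: (Fch _ Fa B SB).
move=> a b /set_mem/sE[Fa sa] /set_mem/sE[Fb sb] ab.
by rewrite -sa -sb (Finj _ _ Fa Fb B SB ab).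
Qed.

Lemma cardT_le_total (K L : Type) :
  [set: K] #<= [set: L] \/ [set: L] #<= [set: K].
Proof.
pose A : set (K + L) := range inl.
pose B : set (K + L) := range inr.
have AK : A #= [set: K] by apply: inj_card_eq => x y _ _ [].
have BL : B #= [set: L] by apply: inj_card_eq => x y _ _ [].
have [|C CAB minC] := @least_set_in _ [set C | C = A \/ C = B].
  by exists A; left.
case: CAB minC => -> /[dup] /(_ _ (or_introl erefl)) h1
  /(_ _ (or_intror erefl)) h2.
- by left; rewrite -(card_le_eql AK) -(card_le_eqr BL).
- by right; rewrite -(card_le_eql BL) -(card_le_eqr AK).
Qed.

Lemma least_cardinalP (P : Type -> Prop) :
  (exists M, P M) -> is_least_cardinal P (least_cardinal P).
Proof.
move=> [M0 PM0]; rewrite /least_cardinal.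
case: pselect => [exL|[]]; first by case: (cid exL).
have [|A [L PL LA] minA] :=
    @least_set_in M0 [set A | exists2 L, P L & [set: L] #= A].
  by exists setT, M0.
exists L; split=> // M PM; rewrite (card_le_eql LA).
have [MM0|M0M] := cardT_le_total M M0.
- have /card_leP[f] := MM0.
  pose g (x : M) : M0 := val (f (SigSub (mem_set (I : [set: M] x)))).
  have MB : [set: M] #= range g.
    rewrite card_eq_sym; apply: inj_card_eq => x y _ _ /val_inj.
    by move=> /(inj (mem_set I) (mem_set I))[].
  by rewrite (card_le_eqr MB); apply: minA; exists M.
- by apply: card_le_trans M0M; apply: minA; exists M0.
Qed.

Definition linear_span (R : realType) (V : lmodType R) (D : set V) : set V :=
  smallest [set Y : set V | GRing.submod_closed (mem Y)] D.

Definition dens (R : realType) (Z : normedModType R) : Type :=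
  least_cardinal (fun M =>
    exists D : set Z, D #= [set: M] /\ dense (linear_span D)).

Section universal_disposition.
Variables (R : realType) (X : completeNormedModType R).

(* [t : Z -> X] stands for the map [Y -> X] it restricts to; its values outside
   of [Y] are irrelevant. *)
Definition isometry_on (Z : normedModType R) (Y : set Z) (t : Z -> X) : Prop :=
  (forall (a : R) (u v : Z), Y u -> Y v -> t (a *: u + v) = a *: t u + t v) /\
  (forall y : Z, Y y -> `|t y| = `|y|).

Definition universal_disposition (K : Type) : Prop :=
  forall (Z : normedModType R) (Y : set Z) (t : Z -> X),
    GRing.submod_closed (mem Y) -> card_lt (dens Z) K -> isometry_on Y t ->
    exists T : {linear Z -> X},
      (forall y : Z, Y y -> T y = t y) /\ (forall z : Z, `|T z| = `|z|).

Definition almost_universal_disposition (K : Type) : Prop :=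
  forall (Z : normedModType R) (Y : set Z) (t : Z -> X),
    GRing.submod_closed (mem Y) -> card_lt (dens Z) K -> isometry_on Y t ->
    forall e : R, 0 < e ->
    exists T : {linear Z -> X},
      (forall y : Z, Y y -> T y = t y) /\
      (forall z : Z, (1 - e) * `|z| <= `|T z| <= (1 + e) * `|z|).

End universal_disposition.

Section daugavet.
Variables (R : realType) (X : completeNormedModType R).

Definition unit_ball : set X := [set x | `|x| <= 1].

Definition unit_sphere : set X := [set x | `|x| = 1].

Definition is_slice (S : set X) : Prop :=
  exists (f : {linear X -> R^o}) (a : R),
    [/\ continuous f, 0 < a &
        S = [set x | unit_ball x /\ sup (f @` unit_ball : set R) - a < f x]].

Definition daugavet_property (K : Type) : Prop :=
  forall A S : set X, A `<=` unit_sphere -> A #<= [set: K] -> is_slice S ->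
  forall e : R, 0 < e ->
  exists2 x, S x & forall y, A y -> 2 - e < `|y + x|.

Definition perfect_daugavet_property (K : Type) : Prop :=
  forall A S : set X, A `<=` unit_sphere -> A #<= [set: K] -> is_slice S ->
  exists2 x, S x & forall y, A y -> `|y + x| = 2.

(* Meaningful for nonzero [X] only: the zero space has both properties for
   every cardinal. *)
Definition Dau : Type := least_cardinal (fun M => ~ daugavet_property M).

Definition pDau : Type :=
  least_cardinal (fun M => ~ perfect_daugavet_property M).

End daugavet.

(* Main.v *)
Require Import Defs.
From HB Require Import structures.
From mathcomp Require Import all_boot all_order all_algebra.
From mathcomp Require Import all_classical all_reals all_analysis.
From mathcomp Require Import ring lra.
(* To find a point of a slice S at distance 2 from all [- y], [y] in a set A of
   fewer than K unit vectors, pick x0 in S. In a space Z spanned by A, x0 and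
   finitely many new unit vectors e_1, ..., e_n, arrange that |y + e_i| = 2 for
   every unit vector y of X while the mean of the e_i is at distance at most
   2 / n from x0. Since dens Z < K, the inclusion of A and x0 in X extends to
   T : Z -> X. The mean of the T e_i is close to x0, so the functional defining
   S is large at some T e_i, which is the desired point. *)

Set Implicit Arguments.
Unset Strict Implicit.
Unset Printing Implicit Defensive.
Import Order.TTheory GRing.Theory Num.Theory.
Import numFieldNormedType.Exports.
Local Open Scope classical_set_scope.
Local Open Scope card_scope.
Local Open Scope ring_scope.

(** * Cardinal arithmetic *)

Lemma card_le_setU_countable (T : Type) (A F : set T) :
  infinite_set A -> countable F -> A `|` F #<= A.
Proof.
move=> infA cF.
have /card_leP[g'] : [set: nat] #<= A by apply/infiniteP.
pose g (n : nat) : T := val (g' (SigSub (mem_set (I : [set: nat] n)))).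
have gA n : A (g n) by exact: set_mem (valP (g' _)).
have gI : injective g.
  by move=> m n /val_inj /(inj (mem_set I) (mem_set I)) [].
have /countable_injP[h hI] := cF.
(* Hilbert's hotel: inside [A], the points [g n] move to [g (2 n)] and all others stay; the points
   of [F] outside [A] go to the freed odd places. *)
pose k x := if x \in A then
  (if pselect (exists n, g n = x) is left e then g (sval (cid e)).*2 else x)
  else g (h x).*2.+1.
suff /injfunPex[f] : exists2 f : T -> T, set_fun (A `|` F) A f
    & set_inj (A `|` F) f by exact: inj_card_le.
have ganti m n : g m.*2 = g n.*2.+1 -> False.
  by move/gI/(congr1 odd); rewrite /= !odd_double.
exists k.
  move=> x _; rewrite /k; case: ifPn => [/set_mem Ax|_]; last exact: gA.
  by case: pselect.
move=> x y /set_mem xAF /set_mem yAF; rewrite /k.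
case: ifPn => [/set_mem Ax|/negP nAx]; case: ifPn => [/set_mem Ay|/negP nAy].
- case: pselect => [ex|nx]; case: pselect => [ey|ny] //.
  + move/gI/double_inj => E.
    by rewrite -(svalP (cid ex)) -(svalP (cid ey)) E.
  + by move=> E; case: ny; eexists; exact: E.
  + by move=> E; case: nx; eexists; rewrite E.
- case: pselect => [ex|nx] E; first by case: (ganti _ _ E).
  by case: nx; eexists; rewrite E.
- case: pselect => [ey|ny] E; first by case: (ganti _ _ (esym E)).
  by case: ny; eexists; rewrite -E.
- move/gI => [] /double_inj; apply: hI; apply/mem_set.
  + by case: xAF => // /mem_set.
  + by case: yAF => // /mem_set.
Qed.

(** If [A] is infinite, adding [F] does not enlarge it, so [K] would inject in [M]; if [A] is
    finite, [K] would be finite. *)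
Lemma card_lt_setU_finite (K M T : Type) (A F : set T) :
  infinite_set [set: K] -> card_lt M K -> A #<= [set: M] -> finite_set F ->
  ~ ([set: K] #<= A `|` F).
Proof.
move=> infK [_ nKM] AM finF KAF.
have [finA|infA] := pselect (finite_set A).
  by apply: infK; apply: card_le_finite KAF _; rewrite finite_setU.
apply: nKM; apply: card_le_trans KAF (card_le_trans _ AM).
exact/card_le_setU_countable/finite_set_countable.
Qed.

(** By comparability, a least cardinal not above [K] would lie strictly below it, where [P] fails.
    The existence hypothesis rules out the junk value of [least_cardinal]. *)
Lemma least_cardinal_ge (P : Type -> Prop) (K : Type) :
  (exists M, P M) -> (forall M, card_lt M K -> ~ P M) ->
  [set: K] #<= [set: least_cardinal P].
Proof.
move=> /least_cardinalP[PL _] nP.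
have [//|LK] := cardT_le_total K (least_cardinal P).
by apply: contrapT => nKL; exact: nP (conj LK nKL) PL.
Qed.

(** * Building normed spaces from norm functions *)

Section norms.
Variable R : realType.

Definition is_norm (V : lmodType R) (N : V -> R) : Prop :=
  [/\ forall u v, N (u + v) <= N u + N v,
      forall (c : R) u, N (c *: u) = `|c| * N u &
      forall u, N u = 0 -> u = 0].

(** A copy of [V] indexed by the proof that [N] is a norm, so that the norm instance can be inferred
    from the type. *)
Definition renorm (V : lmodType R) (N : V -> R) of is_norm N : Type := V.

Section renorm.
Variables (V : lmodType R) (N : V -> R) (hN : is_norm N).

HB.instance Definition _ := GRing.Lmodule.on (renorm hN).

Let normD (u v : renorm hN) : N (u + v) <= N u + N v.
Proof. by have [h _ _] := hN; exact: h. Qed.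
Let normZ (c : R) (u : renorm hN) : N (c *: u) = `|c| * N u.
Proof. by have [_ h _] := hN; exact: h. Qed.
Let norm0 (u : renorm hN) : N u = 0 -> u = 0.
Proof. by have [_ _ h] := hN; exact: h. Qed.

HB.instance Definition _ :=
  Lmodule_isNormed.Build R (renorm hN) normD normZ norm0.

End renorm.

(** * Linear spans as normed spaces, and their density *)

Section span.
Variables (V : lmodType R) (D : set V).

Lemma sub_linear_span : D `<=` linear_span D.
Proof. exact: sub_gen_smallest. Qed.

Lemma linear_span_sub (Y : set V) :
  GRing.submod_closed (mem Y) -> D `<=` Y -> linear_span D `<=` Y.
Proof. exact: smallest_sub. Qed.

Definition in_span : {pred V} := fun v => v \in linear_span D.

Lemma in_span_submod : GRing.submod_closed in_span.
Proof.
split=> [|c u v /set_mem Du /set_mem Dv]; apply/mem_set => Y [Ysub DY].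
  by have [/set_mem] := Ysub.
have [_ Ylin] := Ysub; apply: set_mem; apply: Ylin; apply/mem_set.
- exact: Du.
- exact: Dv.
Qed.

HB.instance Definition _ := GRing.isSubmodClosed.Build R V in_span
  in_span_submod.

Definition span_type : Type := {v : V | v \in in_span}.

HB.instance Definition _ :=
  [isSub for @sval V (fun v => v \in in_span) : span_type -> V].
HB.instance Definition _ := [Choice of span_type by <:].
HB.instance Definition _ := [SubChoice_isSubLmodule of span_type by <:].

(** The image in [V] of a submodule of the span that contains [D] is a submodule of [V] containing
    [D], hence contains the whole span. *)
Lemma linear_span_setT :
  linear_span [set z : span_type | D (val z)] = [set: span_type].
Proof.
apply/seteqP; split=> // z _ Y [Ysub DY].
have : linear_span D (val z) by exact/set_mem/(valP z).
have /linear_span_sub : GRing.submod_closed (mem (val @` Y)).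
  have [/set_mem Y0 Ylin] := Ysub; split=> [|c u v].
    by apply/mem_set; exists 0 => //; rewrite raddf0.
  move=> /set_mem[u' Yu <-] /set_mem[v' Yv <-]; apply/mem_set.
  exists (c *: u' + v'); last by rewrite linearP.
  by apply/set_mem/Ylin; apply/mem_set.
move=> /[apply]; case.
  move=> v Dv; have vD : v \in in_span := mem_set (sub_linear_span Dv).
  by exists (Sub v vD); rewrite ?SubK//; apply: DY.
by move=> z' Yz' /val_inj <-.
Qed.

Lemma is_norm_span (N : V -> R) :
  is_norm N -> is_norm (fun z : span_type => N (val z)).
Proof.
case=> ND NZ N0; split=> [u v|c u|u /N0 u0].
- by rewrite raddfD ND.
- by rewrite linearZ NZ.
- by apply: val_inj; rewrite u0 raddf0.
Qed.

(** Inside its own span [D] generates everything, which is dense whatever the norm. *)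
Lemma dens_span (N : span_type -> R) (hN : is_norm N) :
  [set: dens (renorm hN)] #<= D.
Proof.
pose D' : set (renorm hN) := [set z : span_type | D (val z)].
have D'D : D' #<= D.
  suff /injfunPex[f] : exists2 f : span_type -> V, set_fun D' D f & set_inj D' f.
    exact: inj_card_le.
  by exists val => // u v _ _ /val_inj.
apply: card_le_trans D'D.
pose P M := exists E : set (renorm hN), E #= [set: M] /\ dense (linear_span E).
have PD' : P (set_type D').
  exists D'; split; first exact: card_setT_sym.
  by rewrite /D' linear_span_setT => O [z Oz] _; exists z.
have [_ /(_ _ PD')] := least_cardinalP (ex_intro _ _ PD').
by rewrite (card_le_eqr (card_setT D')).
Qed.

End span.

(** Minimizing a jointly sublinear [G] over the scalar gives a quotient seminorm. The bound of
    [G u 0] by [C * G u s] makes it definite: a zero infimum forces [G u 0 = 0]. *)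
Lemma is_norm_inf (V : lmodType R) (G : V -> R -> R) (C : R) :
  (forall u v s t, G (u + v) (s + t) <= G u s + G v t) ->
  (forall c u s, G (c *: u) (c * s) = `|c| * G u s) ->
  (forall u s, 0 <= G u s) ->
  (forall u s, G u 0 <= C * G u s) ->
  (forall u, G u 0 = 0 -> u = 0) ->
  is_norm (fun u => inf (range (G u))).
Proof.
move=> GD GZ G0 GC Geq0.
have rG u : range (G u) !=set0 by exists (G u 0), 0.
have lbG u : has_lbound (range (G u)) by exists 0 => _ [s _ <-].
have infle u s : inf (range (G u)) <= G u s by apply: ge_inf => //; exists s.
have inf0 u : 0 <= inf (range (G u)) by apply: lb_le_inf => // _ [s _ <-].
have infZle c u : inf (range (G (c *: u))) <= `|c| * inf (range (G u)).
  have [->|c0] := eqVneq c 0.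
    rewrite normr0 mul0r; apply: le_trans (infle _ (0 * 0)) _.
    by rewrite GZ normr0 mul0r.
  rewrite -ler_pdivrMl ?normr_gt0//; apply: lb_le_inf => // _ [s _ <-].
  by rewrite ler_pdivrMl ?normr_gt0// -GZ.
split=> [u v|c u|u u0].
- rewrite -lerBlDr; apply: lb_le_inf => // _ [s _ <-].
  rewrite lerBlDr -lerBlDl; apply: lb_le_inf => // _ [t _ <-].
  by rewrite lerBlDl; apply: le_trans (infle _ _) (GD _ _ s t).
- apply/le_anti; rewrite infZle/=.
  have [->|c0] := eqVneq c 0; first by rewrite normr0 mul0r.
  (* The reverse inequality is [infZle] for [c^-1] and [c *: u]. *)
  rewrite -ler_pdivlMl ?normr_gt0// -normfV.
  by rewrite -[in leLHS](scalerK c0 u).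
- have [C0|C0] := leP C 0.
    apply/Geq0/le_anti; rewrite G0 andbT (le_trans (GC u 0))//.
    exact: mulr_le0_ge0.
  apply/Geq0/le_anti; rewrite G0 andbT.
  have : C^-1 * G u 0 <= inf (range (G u)).
    by apply: lb_le_inf => // _ [s _ <-]; rewrite ler_pdivrMl.
  by rewrite u0 ler_pdivrMl// mulr0.
Qed.

(** * The amalgam of [X] with [n.+1] new vectors *)

Section amalgam.
Variables (X : normedModType R) (x0 : X) (n : nat).
Hypothesis x0_le1 : `|x0| <= 1.

Let N : R := n.+1%:R.
Let N0 : 0 < N. Proof. by rewrite ltr0n. Qed.

Let shift_le x t : `|x| <= `|x + t *: x0| + `|t|.
Proof.
rewrite -{1}[x](addrK (t *: x0)) (le_trans (ler_normB _ _))// lerD2l.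
by rewrite normrZ ler_piMr.
Qed.

(** The cost of splitting [u] into an element of [X], a combination of the [e_i], and [t] times the
    mean of the [e_i] minus [x0], the latter vector being charged [2 / n.+1]. *)
Definition amalgam_cost (u : (X * 'rV[R]_n.+1)%type) (t : R) : R :=
  `|u.1 + t *: x0| + \sum_i `|u.2 0 i - t / n.+1%:R| + 2 / n.+1%:R * `|t|.

(* The gauge of the convex hull of the unit ball of [X], of the vectors [± e_i]
   and of [± (n / 2) (mean of the e_i - x0)]; here [n.+1] plays the role of [n],
   and [t] is the coefficient of the last vector, up to scaling. *)
Definition amalgam_norm (u : (X * 'rV[R]_n.+1)%type) : R :=
  inf (range (amalgam_cost u)).

Lemma amalgam_cost_ge0 u t : 0 <= amalgam_cost u t.
Proof. by rewrite /amalgam_cost !addr_ge0// sumr_ge0. Qed.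

Lemma is_norm_amalgam : is_norm amalgam_norm.
Proof.
(* Replacing [s] by [0] raises each of the first two terms of the cost by at most [|s|], and [N]
   times the last term is [2 |s|]; hence the constant [1 + N]. *)
apply: (@is_norm_inf _ _ (1 + N)) => [u v s t|c u s| |u s|u].
- rewrite /amalgam_cost/= scalerDl.
  have h1 : `|u.1 + v.1 + (s *: x0 + t *: x0)| <= `|u.1 + s *: x0| + `|v.1 + t *: x0|.
    by rewrite addrACA ler_normD.
  have h2 : \sum_i `|(u.2 + v.2) 0 i - (s + t) / n.+1%:R| <=
      \sum_i `|u.2 0 i - s / n.+1%:R| + \sum_i `|v.2 0 i - t / n.+1%:R|.
    rewrite -big_split/=; apply: ler_sum => i _.
    by rewrite mxE mulrDl opprD addrACA ler_normD.
  have h3 : 2 / N * `|s + t| <= 2 / N * `|s| + 2 / N * `|t|.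
    by rewrite -mulrDr ler_wpM2l ?ler_normD// divr_ge0// ltW.
  by rewrite [leRHS]addrACA [X in _ <= X + _]addrACA; exact: lerD (lerD h1 h2) h3.
- rewrite /amalgam_cost/= -scalerA -scalerDr normrZ !mulrDr normrM.
  rewrite mulr_sumr [2 / _ * (_ * _)]mulrCA; congr (_ + _ + _).
  by apply: eq_bigr => i _; rewrite mxE -mulrA -mulrBr normrM.
- exact: amalgam_cost_ge0.
- rewrite /amalgam_cost/= scale0r addr0 normr0 mulr0 addr0.
  have h2 : \sum_i `|u.2 0 i - 0 / n.+1%:R| <=
      \sum_i `|u.2 0 i - s / n.+1%:R| + `|s|.
    have -> : `|s| = \sum_(i < n.+1) `|s / n.+1%:R|.
      rewrite sumr_const card_ord normrM normfV (ger0_norm (ltW N0)).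
      by rewrite -mulr_natr divfK// gt_eqF.
    rewrite -big_split/=; apply: ler_sum => i _; rewrite mul0r subr0.
    by rewrite -{1}[u.2 0 i](subrK (s / n.+1%:R)) ler_normD.
  have h3 : N * (2 / N * `|s|) = 2 * `|s| by field; rewrite gt_eqF.
  have p2 : 0 <= \sum_i `|u.2 0 i - s / n.+1%:R| by exact: sumr_ge0.
  have p3 : 0 <= 2 / N * `|s| by rewrite mulr_ge0// divr_ge0// ltW.
  apply: le_trans (lerD (shift_le _ s) h2) _; rewrite mulrDl mul1r mulrDr h3.
  have key (a b c w q : R) : 0 <= w -> 0 <= q ->
    a + c + (b + c) <= a + b + w + (q + 2 * c) by lra.
  by apply: key => //; rewrite mulr_ge0 ?addr_ge0// ltW.
- move=> /eqP; rewrite /amalgam_cost/= scale0r addr0 normr0 mulr0 addr0.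
  rewrite paddr_eq0//; last exact: sumr_ge0.
  rewrite normr_eq0 psumr_eq0//; case: u => a b /= /andP[/eqP -> /allP b0].
  congr pair; apply/rowP => i; rewrite mxE.
  by have := b0 i (mem_index_enum i); rewrite mul0r subr0 normr_eq0 => /eqP.
Qed.

Let infE u c : (forall t, c <= amalgam_cost u t) -> c <= amalgam_norm u.
Proof.
by move=> h; apply: lb_le_inf => [|_ [t _ <-]//]; exists (amalgam_cost u 0), 0.
Qed.

Let amalgam_norm_le u t : amalgam_norm u <= amalgam_cost u t.
Proof.
apply: ge_inf; last by exists t.
by exists 0 => _ [s _ <-]; exact: amalgam_cost_ge0.
Qed.

(** Moving [x] along [x0] saves at most [|t|], while the coordinates then cost exactly [|t|]. *)
Lemma amalgam_normX x : amalgam_norm (x, 0) = `|x|.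
Proof.
apply/le_anti/andP; split.
  apply: le_trans (amalgam_norm_le _ 0) _; rewrite /amalgam_cost/=.
  rewrite scale0r addr0 normr0 mulr0 addr0 big1 ?addr0// => i _.
  by rewrite mxE mul0r subrr normr0.
apply: infE => t; rewrite /amalgam_cost/=.
have -> : \sum_i `|(0 : 'rV[R]_n.+1) 0 i - t / n.+1%:R| = `|t|.
  under eq_bigr do rewrite mxE sub0r normrN.
  rewrite sumr_const card_ord normrM normfV (ger0_norm (ltW N0)).
  by rewrite -mulr_natr divfK// gt_eqF.
by rewrite (le_trans (shift_le _ t))// lerDl mulr_ge0// divr_ge0// ltW.
Qed.

Lemma amalgam_norm_delta i : amalgam_norm (0, delta_mx 0 i) <= 1.
Proof.
apply: le_trans (amalgam_norm_le _ 0) _; rewrite /amalgam_cost/=.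
rewrite scale0r addr0 !normr0 mulr0 addr0 add0r (bigD1 i)//= big1 => [|j ji].
  by rewrite mxE !eqxx mul0r subr0 normr1 addr0.
by rewrite mxE (negbTE ji) mul0r subr0 normr0.
Qed.

(* Moving along [x0] may lower the first two terms of the cost by
   [|t| (2 / n)] at most, which the weight of [|t|] compensates exactly. *)
Lemma amalgam_norm_add y i : `|y| = 1 -> 2 <= amalgam_norm (y, delta_mx 0 i).
Proof.
move=> y1; apply: infE => t; rewrite /amalgam_cost/= (bigD1 i)//= !mxE !eqxx/=.
have h1 : 1 - `|t| <= `|y + t *: x0|.
  by rewrite lerBlDr -y1 shift_le.
have h2 : 1 - `|t| / N <= `|1 - t / N|.
  have -> : `|t| / N = `|t / N| by rewrite normrM normfV (ger0_norm (ltW N0)).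
  by have := lerB_dist 1 (t / N); rewrite normr1.
have h3 : \sum_(j < n.+1 | j != i) `|(delta_mx 0 i : 'rV[R]_n.+1) 0 j - t / n.+1%:R|
    = `|t| - `|t| / N.
  rewrite (eq_bigr (fun=> `|t| / N)) => [|j ji].
    rewrite sumr_const cardC1 card_ord -mulr_natr.
    have nE : n%:R = N - 1 by rewrite /N -natr1 addrK.
    by rewrite /= nE mulrBr mulr1 divfK// gt_eqF.
  by rewrite mxE (negbTE ji) sub0r normrN normrM normfV (ger0_norm (ltW N0)).
rewrite h3 -mulrA [_^-1 * _]mulrC.
have key (p q c d : R) : 1 - c <= p -> 1 - d <= q ->
  2 <= p + (q + (c - d)) + 2 * d by lra.
exact: key.
Qed.

Lemma amalgam_norm_mean :
  amalgam_norm (- x0, \row_i n.+1%:R^-1) <= 2 / n.+1%:R.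
Proof.
(* At [t = 1] the first two terms vanish. *)
apply: le_trans (amalgam_norm_le _ 1) _; rewrite /amalgam_cost/=.
rewrite scale1r addNr normr0 add0r normr1 mulr1 big1 ?add0r// => i _.
by rewrite mxE mul1r subrr normr0.
Qed.

End amalgam.
End norms.

(** * From extensions of isometries to far points in slices *)

Section disposition.
Variables (R : realType) (X : completeNormedModType R).

(* [e = 0] is universal disposition, all [e > 0] is almost universal disposition. *)
Definition extends_isometries (K : Type) (e : R) : Prop :=
  forall (Z : normedModType R) (Y : set Z) (t : Z -> X),
    GRing.submod_closed (mem Y) -> card_lt (dens Z) K -> isometry_on Y t ->
    exists T : {linear Z -> X},
      (forall y : Z, Y y -> T y = t y) /\
      (forall z : Z, (1 - e) * `|z| <= `|T z| <= (1 + e) * `|z|).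

(** The vectors are [T e_i / (1 + e)], with [T] extending the inclusion of [A] and [x0]. Division by
    [1 + e] puts them in the unit ball and moves each by at most [e]; [T] itself loses at most [2 e]
    on the norm [2] of [y + e_i], whence [3 * e]. *)
Lemma exists_far_family (K M : Type) (e : R) (A : set X) (x0 : X) (n : nat) :
  infinite_set [set: K] -> 0 <= e -> extends_isometries K e ->
  card_lt M K -> A #<= [set: M] -> A `<=` @unit_sphere R X -> `|x0| <= 1 ->
  exists x : 'I_n.+1 -> X,
    [/\ forall i, `|x i| <= 1,
        forall y i, A y -> 2 - 3 * e <= `|y + x i| &
        `|n.+1%:R^-1 *: \sum_i x i - x0| <= 2 / n.+1%:R * (1 + e) + e].
Proof.
move=> infK e0; have key (w a b : R) : 2 <= w -> w <= 2 -> (1 - e) * w <= a ->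
    a <= b + e -> 2 - 3 * e <= b.
  move=> w2 w2' wa ab; have : e * w <= e * 2 by rewrite ler_wpM2l.
  by rewrite mulrBl mul1r in wa; lra.
move=> ext MK AM AS x0_le1.
pose V := (X * 'rV[R]_n.+1)%type.
pose F : set V := (x0, 0) |` range (fun i => (0, delta_mx 0 i)).
(* Only the span of [D] is used as domain, because the density of all of [V] may be too large. *)
pose D : set V := (fun y => (y, 0)) @` A `|` F.
have finF : finite_set F.
  rewrite /F finite_setU; split; first exact: finite_set1.
  by apply: finite_image; exact: finite_finset.
pose hN := is_norm_span D (is_norm_amalgam n x0_le1).
pose Z : normedModType R := renorm hN.
pose pr (z : Z) : V := val (z : span_type D).
have normE (z : Z) : `|z| = amalgam_norm x0 (pr z) by [].
have prP (c : R) (u v : Z) : pr (c *: u + v) = c *: pr u + pr v by exact: linearP.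
have lift v : D v -> exists z : Z, pr z = v.
  move=> Dv; have vD : v \in in_span D := mem_set (sub_linear_span Dv).
  by exists (Sub v vD : span_type D).
have ZK : card_lt (dens Z) K.
  have nKD : ~ ([set: K] #<= [set: dens Z]).
    move=> KZ; apply: (card_lt_setU_finite infK MK _ finF).
      exact: card_le_trans (card_image_le (fun y => (y, 0) : V) A) AM.
    exact: card_le_trans KZ (dens_span hN).
  by split=> //; have [//|] := cardT_le_total (dens Z) K.
(* [Y] is the part of [Z] lying in [X]; the first projection is isometric on it by [amalgam_normX],
   and prescribing it there makes [T] fix [A] and [x0]. *)
pose Y : set Z := [set z | (pr z).2 = 0].
have Ysub : GRing.submod_closed (mem Y).
  split=> [|c u v /set_mem u0 /set_mem v0]; apply/mem_set => //.
  change ((pr (c *: u + v)).2 = 0).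
  by rewrite prP/= (u0 : (pr u).2 = 0) (v0 : (pr v).2 = 0) scaler0 addr0.
have [|T [TY Tnorm]] := ext Z Y (fun z => (pr z).1) Ysub ZK.
  split=> [c u v _ _|z Yz]; first by rewrite prP.
  by rewrite normE -(amalgam_normX n x0_le1) -Yz -surjective_pairing.
have /cid[zx zxE] : exists z : Z, pr z = (x0, 0) by apply: lift; right; left.
have zE i : {z : Z | pr z = (0, delta_mx 0 i)}.
  by apply/cid/lift; right; right; exists i.
pose z i : Z := sval (zE i).
have prz i : pr (z i) = (0, delta_mx 0 i) := svalP (zE i).
have z_le1 i : `|z i| <= 1 by rewrite normE prz amalgam_norm_delta.
have e1 : 0 < 1 + e by rewrite ltr_wpDr.
have e1u : 1 + e != 0 by rewrite gt_eqF.
have Tz i : `|T (z i)| <= 1 + e.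
  have /andP[_ h] := Tnorm (z i); apply: le_trans h _.
  by rewrite ler_piMr// ltW.
have TzB i : `|(1 + e)^-1 *: T (z i) - T (z i)| <= e.
  have -> : (1 + e)^-1 *: T (z i) - T (z i) = - (e / (1 + e)) *: T (z i).
    by rewrite -{2}[T (z i)]scale1r -scalerBl; congr (_ *: _); field.
  rewrite normrZ normrN ger0_norm ?divr_ge0// ?(ltW e1)//.
  by rewrite -mulrA ler_piMr// mulrC ler_pdivrMr// mul1r.
exists (fun i => (1 + e)^-1 *: T (z i)); split=> [i|y i Ay|].
- by rewrite normrZ gtr0_norm ?invr_gt0// mulrC ler_pdivrMr// mul1r.
- have [zy zyE] : exists z : Z, pr z = (y, 0) by apply: lift; left; exists y.
  have Tzy : T zy = y by rewrite TY ?zyE// /Y/= zyE.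
  have /andP[h _] := Tnorm (zy + z i); rewrite raddfD/= Tzy in h.
  have prw : pr (zy + z i) = (y, delta_mx 0 i).
    rewrite -[zy]scale1r prP scale1r zyE prz.
    by congr pair; rewrite /= ?addr0 ?add0r.
  have n2 : 2 <= `|zy + z i| by rewrite normE prw; exact/amalgam_norm_add/AS.
  (* As [e] may exceed [1], bounding [(1 - e) * w] from below by [2 - 2 e] takes both [2 <= w] and
     [w <= 2]. *)
  have n2' : `|zy + z i| <= 2.
    rewrite (le_trans (ler_normD _ _))// (_ : 2 = 1 + 1 :> R)// lerD//.
    by rewrite normE zyE amalgam_normX// (AS y).
  have h2 : `|y + T (z i)| <= `|y + (1 + e)^-1 *: T (z i)| + e.
    have -> : y + T (z i) =
        y + (1 + e)^-1 *: T (z i) - ((1 + e)^-1 *: T (z i) - T (z i)).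
      by rewrite opprB addrACA subrr addr0.
    by rewrite (le_trans (ler_normB _ _))// lerD2l.
  exact: key n2 n2' h h2.
- pose m : Z := n.+1%:R^-1 *: \sum_i z i - zx.
  have prm : pr m = (- x0, \row_i n.+1%:R^-1).
    have -> : pr m = n.+1%:R^-1 *: \sum_i pr (z i) - pr zx.
      have prB (u v : Z) : pr (u - v) = pr u - pr v by exact: raddfB.
      have prZ (c : R) (u : Z) : pr (c *: u) = c *: pr u by exact: linearZ.
      rewrite prB prZ; congr (_ *: _ - _).
      exact: (raddf_sum (\val : {linear span_type D -> V})).
    rewrite zxE (eq_bigr _ (fun i _ => prz i)).
    have -> : \sum_i ((0, delta_mx 0 i) : V) = (0, \row_i 1).
      rewrite [LHS]surjective_pairing !raddf_sum/=; congr pair.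
        by rewrite big1.
      by rewrite [RHS]row_sum_delta; apply: eq_bigr => i _; rewrite mxE scale1r.
    congr pair; rewrite /= ?scaler0 ?sub0r//.
    by rewrite subr0; apply/rowP => i; rewrite !mxE mulr1.
  have m_le : `|m| <= 2 / n.+1%:R by rewrite normE prm; exact: amalgam_norm_mean.
  have TmE : T m = n.+1%:R^-1 *: \sum_i T (z i) - x0.
    by rewrite raddfB/= linearZ/= raddf_sum TY ?zxE// /Y/= zxE.
  have Tm_le : `|T m| <= 2 / n.+1%:R * (1 + e).
    have /andP[_ h] := Tnorm m; apply: le_trans h _.
    by rewrite mulrC ler_wpM2r// ltW.
  (* The rescaling adds to [T m] a mean of vectors of norm at most [e]. *)
  have -> : n.+1%:R^-1 *: \sum_i ((1 + e)^-1 *: T (z i)) - x0 =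
    T m + n.+1%:R^-1 *: \sum_i ((1 + e)^-1 *: T (z i) - T (z i)).
    by rewrite TmE big_split/= sumrN scalerDr scalerN addrCA [_ - x0 - _]addrAC subrr sub0r.
  apply: le_trans (ler_normD _ _) _; apply: lerD => //.
  rewrite normrZ gtr0_norm ?invr_gt0// mulrC ler_pdivrMr//.
  apply: le_trans (ler_norm_sum _ _ _) _.
  by rewrite mulr_natr -[n.+1 in leRHS]card_ord -sumr_const ler_sum.
Qed.

Lemma linear_continuous_norm_bound (f : {linear X -> R^o}) : continuous f ->
  exists2 C : R, 0 < C & forall x, `|f x| <= C * `|x|.
Proof.
move=> /linear_bounded_continuous/linear_boundedP/pinfty_ex_gt0[C C0 h].
by exists C.
Qed.

(** The threshold [d] depends on the slice but not on [e], so one statement serves both [e = 0] and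
    arbitrarily small [e > 0]. *)
Lemma exists_far_in_slice (K M : Type) (A S : set X) :
  infinite_set [set: K] -> card_lt M K -> A #<= [set: M] ->
  A `<=` @unit_sphere R X -> is_slice S ->
  exists2 d : R, 0 < d & forall e, 0 <= e <= d -> extends_isometries K e ->
    exists2 x, S x & forall y, A y -> 2 - 3 * e <= `|y + x|.
Proof.
move=> infK MK AM AS [f [a [fc a0 ->]]].
have [C C0 fC] := linear_continuous_norm_bound fc.
set E : set R := f @` _; set s := sup E - a.
have supE : has_sup E.
  split; first by exists 0, 0; rewrite ?raddf0//= /unit_ball/= normr0.
  exists C => _ [x /= x1 <-]; apply: le_trans (ler_norm _) _.
  by apply: le_trans (fC x) _; rewrite ler_piMr// ltW.
have [_ [x0 x01 <-] gt_s] := sup_adherent a0 supE.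
set g := f x0 - s; have g0 : 0 < g by rewrite subr_gt0.
(* The bound [1] gives [1 + e <= 2], the other gives [C * e <= g / 4]; the choice of [n] below makes
   [4 C / n.+1 < g / 2]. Together they give [C * |m| < g]. *)
exists (Num.min 1 (g / (4 * C))) => [|e /andP[e0]].
  by rewrite lt_min ltr01 divr_gt0// mulr_gt0.
rewrite le_min => /andP[e1 eg] ext.
have [n nP] : exists n, 8 * C / g < n.+1%:R.
  by exists (Num.trunc (8 * C / g)); exact: truncnS_gt.
have [x [x1 xA xm]] := exists_far_family n infK e0 ext MK AM AS x01.
have [[i si]|nsi] := pselect (exists i, s < f (x i)).
  by exists (x i) => [|y Ay]; [split=> //; exact: x1|exact: xA].
exfalso; set m := _^-1 *: _ - x0 in xm.
have N0 : 0 < n.+1%:R :> R by [].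
(* If every [x i] misses the slice, then [f] is at most [s] at their mean, which is [g] below
   [f x0]. *)
have fm : f m <= - g.
  rewrite raddfB/= linearZ/= raddf_sum /g opprB lerD2r.
  rewrite [leLHS]mulrC ler_pdivrMr// mulr_natr -[n.+1 in leRHS]card_ord.
  rewrite -sumr_const ler_sum// => i _.
  by rewrite leNgt; apply/negP => si; apply: nsi; exists i.
have : C * `|m| < g.
  have Ce : C * e <= g / 4.
    by move: eg; rewrite ler_pdivlMr ?mulr_gt0// => h; lra.
  have CN : C * (2 / n.+1%:R * (1 + e)) < g / 2.
    have h : C * (4 / n.+1%:R) < g / 2.
      by move: nP; rewrite ltr_pdivrMr// mulrA ltr_pdivrMr// => h; lra.
    apply: le_lt_trans h; rewrite ler_wpM2l// ?(ltW C0)//.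
    rewrite (_ : 4 / n.+1%:R = 2 / n.+1%:R * 2 :> R); last by ring.
    by rewrite ler_wpM2l ?divr_ge0//; lra.
  have : C * `|m| <= C * (2 / n.+1%:R * (1 + e)) + C * e.
    by rewrite -mulrDr ler_wpM2l// ltW.
  move=> /le_lt_trans; apply; apply: lt_le_trans (ltr_leD CN Ce) _.
  by lra.
rewrite ltNge => /negP; apply.
apply: le_trans (fC m); rewrite -normrN; apply: le_trans (ler_norm _).
by rewrite lerNr.
Qed.

(** * Nontriviality: [X] is nonzero and the Daugavet properties fail for some cardinal *)

Lemma is_slice_unit_ball : is_slice (@unit_ball R X).
Proof.
(* The zero functional with margin [1] cuts nothing off the ball. *)
exists \0, 1; split=> //; first exact: cst_continuous.
apply/seteqP; split=> [x x1|x []//]; split=> //=.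
have -> : \0 @` @unit_ball R X = [set 0 : R].
  by apply/seteqP; split=> [_ [y _ <-]//|_ ->]; exists x.
by rewrite sup1 sub0r ltrN10.
Qed.

(** This excludes the zero space, where both properties hold for every cardinal. The zero map on the
    trivial subspace of a line extends to a [T] on the line, and [e < 1] makes [T] nonzero. *)
Lemma extends_isometries_nonzero (K : Type) (e : R) :
  infinite_set [set: K] -> e < 1 -> extends_isometries K e ->
  exists y : X, `|y| = 1.
Proof.
move=> infK e1 ext.
have normR : is_norm (fun x : R^o => `|x|).
  by split; [exact: ler_normD|exact: normrZ|exact: normr0_eq0].
pose hN := is_norm_span [set 1 : R^o] normR.
pose Z : normedModType R := renorm hN.
have ZK : card_lt (dens Z) K.
  have nKZ : ~ ([set: K] #<= [set: dens Z]).
    move=> KZ; apply: infK; apply: card_le_finite (finite_set1 (1 : R^o)).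
    exact: card_le_trans KZ (dens_span hN).
  by split=> //; have [//|] := cardT_le_total (dens Z) K.
pose Y : set Z := [set 0].
have Ysub : GRing.submod_closed (mem Y).
  split=> [|c u v /set_mem -> /set_mem ->]; apply/mem_set => //.
  by rewrite /Y/= scaler0 addr0.
have [|T [_ Tn]] := ext Z Y (fun=> 0) Ysub ZK.
  by split=> [c u v _ _|z ->]; rewrite ?scaler0 ?addr0// !normr0.
have v1 : (1 : R^o) \in in_span [set 1 : R^o] := mem_set (sub_linear_span erefl).
pose z : Z := (Sub (1 : R^o) v1 : span_type [set 1 : R^o]).
have z1 : `|z| = 1 by rewrite -[RHS](@normr1 R).
have Tz : 0 < `|T z|.
  by have /andP[h _] := Tn z; apply: lt_le_trans h; rewrite z1 mulr1 subr_gt0.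
by exists (`|T z|^-1 *: T z); rewrite normrZ normfV normr_id mulVf// gt_eqF.
Qed.

(** Take the whole sphere as the family and the whole ball as the slice: a nonzero [x] in the ball
    is at distance [1 - |x|] from [x / |x|], and [x = 0] is at distance [1] from the sphere. *)
Lemma not_daugavet_property : (exists y : X, `|y| = 1) ->
  ~ daugavet_property X X.
Proof.
move=> [y0 y01] /(_ (@unit_sphere R X) _ (fun _ h => h)
  (subset_card_le (@subsetT _ _)) is_slice_unit_ball 1 ltr01) [x x1 xS].
have x0 : x != 0.
  by apply/eqP => x0; have := xS y0 y01; rewrite x0 addr0 y01; lra.
have nx : `|x| != 0 by rewrite normr_eq0.
have : @unit_sphere R X (- (`|x|^-1 *: x)).
  by rewrite /unit_sphere/= normrN normrZ normfV normr_id mulVf.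
move=> /xS; rewrite ltNge => /negP; apply.
have -> : - (`|x|^-1 *: x) + x = (1 - `|x|^-1) *: x.
  by rewrite scalerBl scale1r addrC.
rewrite normrZ -[in X in _ * X]normr_id -normrM mulrBl mul1r mulVf//.
by rewrite distrC ger0_norm ?subr_ge0// lerBlDr; have := normr_ge0 x; lra.
Qed.

Lemma perfect_daugavet_sub (K : Type) :
  perfect_daugavet_property X K -> daugavet_property X K.
Proof.
move=> h A S AS AK SS e e0; have [x Sx Ax] := h A S AS AK SS.
by exists x => // y /Ax ->; rewrite ltrBlDr ltrDl.
Qed.

End disposition.

(** * The bounds on [pDau] and [Dau] *)

Unset Implicit Arguments.

Theorem theorem8p4 (R : realType) (X : completeNormedModType R) (K : Type)
    (infK : infinite_set [set: K]) :
  (universal_disposition X K -> [set: K] #<= [set: pDau X]) /\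
  (almost_universal_disposition X K -> [set: K] #<= [set: Dau X]).
Proof.
have slice_ball (S : set X) x : is_slice S -> S x -> `|x| <= 1.
  by move=> [f [a [_ _ ->]]] [].
split=> [ud|aud].
- have ext : extends_isometries X K 0.
    move=> Z Y t Ysub ZK tI; have [T [TY TI]] := ud Z Y t Ysub ZK tI.
    by exists T; split=> // z; rewrite TI subr0 addr0 mul1r lexx.
  apply: least_cardinal_ge => [|M MK].
    (* The type [X] itself indexes its unit sphere, so some cardinal fails the property and [pDau X]
       is a genuine least cardinal. *)
    exists X => /perfect_daugavet_sub; apply: not_daugavet_property.
    exact: extends_isometries_nonzero infK ltr01 ext.
  apply; move=> A S AS AM SS.
  (* At [e = 0] the lower bound is exactly [2]; the triangle inequality gives the upper one. *)
  have [d d0 /(_ 0)] := exists_far_in_slice infK MK AM AS SS.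
  rewrite lexx ltW// => /(_ isT ext)[x Sx xA]; exists x => // y Ay.
  apply/le_anti/andP; split; last by have := xA y Ay; rewrite mulr0 subr0.
  rewrite (le_trans (ler_normD _ _))// (AS y Ay) (_ : 2 = 1 + 1 :> R)//.
  by rewrite lerD2l; exact: slice_ball Sx.
- have ext e : 0 < e -> extends_isometries X K e.
    by move=> e0 Z Y t Ysub ZK tI; exact: aud.
  apply: least_cardinal_ge => [|M MK].
    exists X; apply: not_daugavet_property.
    by apply: (extends_isometries_nonzero infK _ (ext 2^-1 _)) => //; lra.
  apply; move=> A S AS AM SS e e0.
  have [d d0 h] := exists_far_in_slice infK MK AM AS SS.
  (* With [c <= e / 4], the loss [3 * c] stays strictly below [e]. *)
  pose c := Num.min d (e / 4).
  have c0 : 0 < c by rewrite lt_min d0 divr_gt0.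
  have cd : 0 <= c <= d by rewrite (ltW c0) ge_min lexx.
  have [x Sx xA] := h c cd (ext c c0).
  exists x => // y Ay; apply: lt_le_trans (xA y Ay).
  have : c <= e / 4 by rewrite ge_min lexx orbT.
  by lra.
Qed.
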